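(* Let $k,l\in\mathbb{Q}\setminus\{0\}$. There exist integers $d_1=d_1(k,l)>0$, $d_2=d_2(k,l)\ge0$ and a constant $K=K(k,l)$ such that for all real random variables $X,Y$ with bounded ranges (not necessarily independent) and all $n\in\mathbb{N}$, $$H_n(kX+lY)-\frac{H_n(X)+H_n(Y)}{2}\le d_1\Big(H_n(X+Y)-\frac{H_n(X)+H_n(Y)}{2}\Big)+d_2\big(H_n(X)+H_n(Y)-H_n(X,Y)\big)+K.$$
   Context: Logarithms base 2. $D_n(x)=\lfloor 2^nx\rfloor/2^n$ coordinatewise. For bounded random variables, $H_n(Z):=H(D_n(Z))$ (Shannon entropy of the discretization) and $H_n(X,Y):=H(D_n(X),D_n(Y))$. *)

(* Defs.v *)
From HB Require Import structures.
From mathcomp Require Import all_boot all_order all_algebra.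
From mathcomp Require Import all_classical all_reals all_analysis.
Set Implicit Arguments. Unset Strict Implicit. Unset Printing Implicit Defensive.
Import Order.TTheory GRing.Theory Num.Theory.
Local Open Scope classical_set_scope.
Local Open Scope ring_scope.

Definition log2 {R : realType} (x : R) : R := ln x / ln 2.

Definition Dn {R : realType} (n : nat) (x : R) : R :=
  (Num.floor (2 ^+ n * x))%:~R / 2 ^+ n.

Definition entropy {d} {T : measurableType d} {R : realType}
  (P : probability T R) {V : choiceType} (f : T -> V) : R :=
  (\sum_(v \in range f) - (fine (P (f @^-1` [set v])) *
                            log2 (fine (P (f @^-1` [set v])))))%R.

Definition Hn {d} {T : measurableType d} {R : realType}
  (P : probability T R) (n : nat) (Z : T -> R) : R :=
  entropy P (fun t => Dn n (Z t)).

Definition Hn2 {d} {T : measurableType d} {R : realType}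
  (P : probability T R) (n : nat) (X Y : T -> R) : R :=
  entropy P (fun t => (Dn n (X t), Dn n (Y t))).

(* Main.v *)
(** Everything is measured up to multiples of [e = delta + 2 I] and additive
constants, where [delta] is the entropy excess of [X + Y] over the average [x]
of the entropies of [X] and [Y], and [I] is the mutual information. Then
[X] and [Y] have entropy about [x], their joint entropy is about [2x], and
[X + Y] has entropy about [x].

If [W] is a function of [U] and also a function of [V], then submodularity
gives [H(W) <= H(U) + H(V) - H(U, V)]. Conditionally independent copies of the
variables over shared coordinates supply the joint laws: with [m] free variables
their joint entropy stays close to [m x] even though [X] and [Y] are dependent.
Writing one linear form in two ways on such a law first allows the sign of [Y]
to be changed, then yields [X - a Y] for integers [a] by induction, and
finally all integer combinations. Discretization errors take boundedly many
values, hence cost [O(1)]. *)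
Require Import Defs.
From HB Require Import structures.
From mathcomp Require Import finmap.
From mathcomp Require Import all_boot all_order all_algebra.
From mathcomp Require Import all_classical all_reals all_analysis.
From mathcomp Require Import measurable_realfun.
From mathcomp Require Import zify ring lra.
Set Implicit Arguments. Unset Strict Implicit. Unset Printing Implicit Defensive.
Import Order.TTheory GRing.Theory Num.Theory.
Local Open Scope classical_set_scope.
Local Open Scope ring_scope.

(** * Entropy on a finite probability space *)

Lemma ln2_gt0 (R : realType) : 0 < ln (2 : R).
Proof. by rewrite ln_gt0 // ltr1n. Qed.

Lemma log2M (R : realType) (x y : R) :
  0 < x -> 0 < y -> log2 (x * y) = log2 x + log2 y.
Proof. by move=> x0 y0; rewrite /log2 lnM ?posrE // mulrDl. Qed.

Lemma log2V (R : realType) (x : R) : 0 < x -> log2 x^-1 = - log2 x.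
Proof. by move=> x0; rewrite /log2 lnV ?posrE // mulNr. Qed.

Lemma log2_le (R : realType) (x y : R) : 0 < x -> x <= y -> log2 x <= log2 y.
Proof.
move=> x0 xy; rewrite /log2 ler_wpM2r ?invr_ge0 ?(ltW (ln2_gt0 R)) //.
by rewrite ler_ln ?posrE // (lt_le_trans x0).
Qed.

Lemma log2_le_sub1 (R : realType) (x : R) : 0 < x -> log2 x <= (x - 1) / ln 2.
Proof.
move=> x0; rewrite /log2 ler_wpM2r ?invr_ge0 ?(ltW (ln2_gt0 R)) //.
have := @le_ln1Dx R (x - 1); rewrite addrCA subrr addr0; apply; lra.
Qed.

Definition pmf {R : realType} {Om : finType} (p : Om -> R) : Prop :=
  (forall w, 0 <= p w) /\ \sum_w p w = 1.

Definition mass {R : realType} {Om : finType} (p : Om -> R) {V : eqType}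
  (f : Om -> V) (v : V) : R := \sum_(w | f w == v) p w.

(* Averaging over the sample space rather than over the values of [f] lets
   [ent] make sense for an arbitrary type of values. *)
Definition ent {R : realType} {Om : finType} (p : Om -> R) {V : eqType}
  (f : Om -> V) : R := - \sum_w p w * log2 (mass p f (f w)).

(** Only points of positive probability count: conditionally independent copies share coordinates
    only on the support of their law. *)
Definition refines {R : realType} {Om : finType} (p : Om -> R) {V W : eqType}
  (g : Om -> V) (f : Om -> W) : Prop :=
  forall w w', 0 < p w -> 0 < p w' -> g w = g w' -> f w = f w'.

Lemma pmf_gt0 (R : realType) (Om : finType) (p : Om -> R) (w : Om) :
  pmf p -> p w != 0 -> 0 < p w.
Proof. by move=> [p0 _] pw; rewrite lt_neqAle eq_sym pw p0. Qed.

Lemma mass_ge0 (R : realType) (Om : finType) (p : Om -> R) (V : eqType)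
  (f : Om -> V) (v : V) : pmf p -> 0 <= mass p f v.
Proof. by move=> [p0 _]; apply: sumr_ge0. Qed.

Lemma mass_ge (R : realType) (Om : finType) (p : Om -> R) (V : eqType)
  (f : Om -> V) (w : Om) : pmf p -> p w <= mass p f (f w).
Proof.
by move=> [p0 _]; rewrite /mass (bigD1 w) //= lerDl; apply: sumr_ge0.
Qed.

Lemma mass_gt0 (R : realType) (Om : finType) (p : Om -> R) (V : eqType)
  (f : Om -> V) (w : Om) : pmf p -> 0 < p w -> 0 < mass p f (f w).
Proof. by move=> pp pw; apply: lt_le_trans pw (mass_ge f w pp). Qed.

Lemma massE (R : realType) (Om : finType) (p : Om -> R) (V : eqType)
  (f : Om -> V) (v : V) : mass p f v = \sum_w p w * (f w == v)%:R.
Proof.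
by rewrite /mass big_mkcond; apply: eq_bigr => w _; case: ifP => _;
  rewrite ?mulr1 ?mulr0.
Qed.

Lemma mass_divK (R : realType) (Om : finType) (p : Om -> R) (V : eqType)
  (f : Om -> V) (w : Om) : pmf p -> p w / mass p f (f w) * mass p f (f w) = p w.
Proof.
move=> pp; have [m0|m0] := eqVneq (mass p f (f w)) 0; last by rewrite divfK.
rewrite m0 mulr0; apply/eqP; rewrite eq_le pp.1 -m0.
by rewrite mass_ge.
Qed.

Lemma mass_refines (R : realType) (Om : finType) (p : Om -> R) (V W : eqType)
  (g : Om -> V) (f : Om -> W) (w : Om) :
  pmf p -> 0 < p w -> refines p g f -> mass p g (g w) <= mass p f (f w).
Proof.
move=> pp pw gf; rewrite !massE; apply: ler_sum => w' _.
have [->|pw'] := eqVneq (p w') 0; first by rewrite !mul0r.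
have {}pw' := pmf_gt0 pp pw'.
case: eqP => [e|_]; last by rewrite mulr0 mulr_ge0 // ltW.
by rewrite (gf _ _ pw' pw e) eqxx.
Qed.

Lemma ent_mono (R : realType) (Om : finType) (p : Om -> R) (V W : eqType)
  (g : Om -> V) (f : Om -> W) : pmf p -> refines p g f -> ent p f <= ent p g.
Proof.
move=> pp gf; rewrite lerN2; apply: ler_sum => w _.
have [->|pw] := eqVneq (p w) 0; first by rewrite !mul0r.
have {}pw := pmf_gt0 pp pw.
by rewrite ler_wpM2l ?(ltW pw) // log2_le ?mass_refines ?mass_gt0.
Qed.

Lemma ent_eq (R : realType) (Om : finType) (p : Om -> R) (V W : eqType)
  (g : Om -> V) (f : Om -> W) :
  pmf p -> refines p g f -> refines p f g -> ent p f = ent p g.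
Proof. by move=> pp gf fg; apply: le_anti; rewrite !ent_mono. Qed.

(** This is the expectation estimate behind submodularity. The masses of [f] and [g] are expanded
    over points [w1] and [w2], after which the inner sum over [w] collapses. *)
Lemma sum_mass_ratio_le1 (R : realType) (Om : finType) (p : Om -> R)
  (W U V : eqType) (h : Om -> W) (f : Om -> U) (g : Om -> V) :
  pmf p -> refines p f h -> refines p g h ->
  \sum_w p w * (mass p f (f w) * mass p g (g w) /
    (mass p h (h w) * mass p (fun w => (f w, g w)) (f w, g w))) <= 1.
Proof.
move=> pp fh gh; set fg := fun w => (f w, g w).
pose D w := mass p h (h w) * mass p fg (fg w).
pose T w1 w2 := \sum_w (p w / D w) * ((f w1 == f w)%:R * (g w2 == g w)%:R).
have -> : \sum_w p w * (mass p f (f w) * mass p g (g w) / D w)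
  = \sum_w1 \sum_w2 p w1 * p w2 * T w1 w2.
  transitivity (\sum_w \sum_w1 \sum_w2 p w1 * p w2 *
     ((p w / D w) * ((f w1 == f w)%:R * (g w2 == g w)%:R))).
    apply: eq_bigr => w _; rewrite !massE mulrCA !mulrA -mulrA mulr_suml.
    rewrite mulr_suml; apply: eq_bigr => w1 _.
    rewrite mulr_sumr mulr_suml; apply: eq_bigr => w2 _.
    by rewrite /D !massE; ring.
  rewrite exchange_big; apply: eq_bigr => w1 _.
  by rewrite exchange_big; apply: eq_bigr => w2 _; rewrite mulr_sumr.
have le w1 w2 : p w1 * p w2 * T w1 w2 <=
    p w1 / mass p h (h w1) * (p w2 * (h w2 == h w1)%:R).
  have [->|pw1] := eqVneq (p w1) 0; first by rewrite !mul0r.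
  have [->|pw2] := eqVneq (p w2) 0; first by rewrite !(mul0r, mulr0).
  have {}pw1 := pmf_gt0 pp pw1; have {}pw2 := pmf_gt0 pp pw2.
  (* Either some [w0] in the support realizes both [f w1] and [g w2], and the mass of [fg] cancels,
     leaving the inverse mass of [h], or every term of [T w1 w2] vanishes. *)
  have [w0 /and3P[pw0 /eqP e1 /eqP e2]|none] :=
      pickP (fun w => [&& 0 < p w, f w1 == f w & g w2 == g w]).
    have -> : T w1 w2 = (mass p h (h w1))^-1.
      have -> : T w1 w2 = \sum_w p w * (fg w == fg w0)%:R / D w0.
        apply: eq_bigr => w _; rewrite e1 e2 -natrM mulnb xpair_eqE.
        rewrite (eq_sym (f w0)) (eq_sym (g w0)).
        have [->|pw] := eqVneq (p w) 0; first by rewrite !mul0r.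
        have {}pw := pmf_gt0 pp pw.
        have [/andP[/eqP ef /eqP eg]|_] := boolP (_ && _);
          last by rewrite !(mul0r, mulr0).
        by rewrite /D /fg ef eg (fh _ _ pw pw0 ef) !mulr1.
      rewrite -mulr_suml -massE /D -(fh _ _ pw1 pw0 e1) invfM mulrCA divff ?mulr1 //.
      by rewrite gt_eqF // mass_gt0.
    have -> : h w2 = h w1.
      by rewrite (fh _ _ pw1 pw0 e1) (gh _ _ pw2 pw0 e2).
    by rewrite eqxx mulr1 mulrAC.
  have -> : T w1 w2 = 0.
    apply: big1 => w _; rewrite -natrM mulnb.
    have [->|pw] := eqVneq (p w) 0; first by rewrite !mul0r.
    by have := none w; rewrite (pmf_gt0 pp pw) /= => ->; rewrite mulr0.
  rewrite mulr0 mulr_ge0 ?divr_ge0 ?mulr_ge0 ?(ltW pw1) ?(ltW pw2) ?mass_ge0 //.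
apply: (@le_trans _ _ (\sum_w1 p w1)); last by rewrite pp.2.
apply: ler_sum => w1 _; rewrite -[leRHS](mass_divK h w1 pp) [X in _ <= _ * X]massE.
by rewrite mulr_sumr; apply: ler_sum => w2 _; exact: le.
Qed.

(** Left side minus right side is the expectation of [log2] of the mass ratio. The bound
    [log2 t <= (t - 1) / ln 2] makes it nonpositive, since the ratio has expectation at most [1]. *)
Lemma ent_submod (R : realType) (Om : finType) (p : Om -> R)
  (W U V : eqType) (h : Om -> W) (f : Om -> U) (g : Om -> V) :
  pmf p -> refines p f h -> refines p g h ->
  ent p h + ent p (fun w => (f w, g w)) <= ent p f + ent p g.
Proof.
move=> pp fh gh; set fg := fun w => (f w, g w).
have pos (X : eqType) (k : Om -> X) w : 0 < p w -> 0 < mass p k (k w).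
  exact: mass_gt0.
rewrite -subr_le0 /ent.
have -> : - (\sum_w p w * log2 (mass p h (h w))) +
   - (\sum_w p w * log2 (mass p fg (fg w))) -
   (- (\sum_w p w * log2 (mass p f (f w))) +
    - (\sum_w p w * log2 (mass p g (g w)))) =
   \sum_w p w * log2 (mass p f (f w) * mass p g (g w) /
           (mass p h (h w) * mass p fg (fg w))).
  rewrite -!sumrN -!big_split -!sumrN -!big_split; apply: eq_bigr => w _ /=.
  have [->|pw] := eqVneq (p w) 0; first by rewrite !(mul0r, oppr0, addr0).
  have {}pw := pmf_gt0 pp pw.
  rewrite log2M ?log2V ?log2M ?divr_gt0 ?invr_gt0 ?mulr_gt0 ?pos //; last first.
  ring.
pose q w := mass p f (f w) * mass p g (g w) /
           (mass p h (h w) * mass p fg (fg w)).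
apply: (@le_trans _ _ (\sum_w (p w * q w - p w) / ln 2)).
  apply: ler_sum => w _.
  have [->|pw] := eqVneq (p w) 0; first by rewrite !mul0r subrr mul0r.
  have {}pw := pmf_gt0 pp pw.
  have -> : (p w * q w - p w) / ln 2 = p w * ((q w - 1) / ln 2) by ring.
  rewrite ler_wpM2l ?(ltW pw) //.
  by apply: log2_le_sub1; rewrite divr_gt0 ?mulr_gt0 ?pos.
rewrite -mulr_suml sumrB pp.2 pmulr_lle0 ?invr_gt0 ?ln2_gt0 // subr_le0.
exact: sum_mass_ratio_le1.
Qed.

Lemma ent_subadd (R : realType) (Om : finType) (p : Om -> R)
  (U V : eqType) (f : Om -> U) (g : Om -> V) :
  pmf p -> ent p (fun w => (f w, g w)) <= ent p f + ent p g.
Proof.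
move=> pp; have := @ent_submod _ _ p unit U V (fun=> tt) f g pp.
suff -> : ent p (fun=> tt) = 0 by rewrite add0r; apply.
rewrite /ent big1 ?oppr0 // => w _; rewrite /mass.
rewrite (eq_bigl (fun=> true)); last by move=> ?; rewrite eqxx.
by rewrite pp.2 /log2 ln1 mul0r mulr0.
Qed.

(** A linear bound on the logarithm replaces the sharp [log2 #|D|], as only some constant is needed.
    Each value of [f] contributes at most [1] to the sum of [p w / mass p f (f w)]. *)
Lemma ent_le_card (R : realType) (Om D : finType) (p : Om -> R) (f : Om -> D) :
  pmf p -> ent p f <= #|D|%:R / ln 2.
Proof.
move=> pp; rewrite /ent -sumrN.
apply: (@le_trans _ _ (\sum_w p w / mass p f (f w) / ln 2)).
  apply: ler_sum => w _.
  have [->|pw] := eqVneq (p w) 0; first by rewrite !mul0r oppr0.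
  have {}pw := pmf_gt0 pp pw.
  have m0 : 0 < mass p f (f w) by exact: mass_gt0.
  rewrite -mulrN -log2V // -mulrA ler_wpM2l ?(ltW pw) //.
  apply: le_trans (log2_le_sub1 _) _; rewrite ?invr_gt0 //.
  by rewrite ler_wpM2r ?invr_ge0 ?(ltW (ln2_gt0 R)) // gerBl.
rewrite -mulr_suml ler_wpM2r ?invr_ge0 ?(ltW (ln2_gt0 R)) //.
rewrite (partition_big f xpredT) //= -sum1_card natr_sum.
apply: ler_sum => v _.
rewrite (eq_bigr (fun w => p w / mass p f v)); last by move=> w /eqP ->.
rewrite -mulr_suml -/(mass p f v).
by have [->|m0] := eqVneq (mass p f v) 0; rewrite ?mul0r ?ler01 // divff.
Qed.

(** * Conditionally independent copies *)

(* The law of two copies of the sample point, conditionally independent given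
   the value of [f]. *)
Definition cond_copy {R : realType} {Om : finType} (p : Om -> R) {S : eqType}
  (f : Om -> S) (w : Om * Om) : R :=
  p w.1 * p w.2 * (f w.1 == f w.2)%:R / mass p f (f w.1).

Lemma cond_copy_swap (R : realType) (Om : finType) (p : Om -> R) (S : eqType)
  (f : Om -> S) (w1 w2 : Om) : cond_copy p f (w1, w2) = cond_copy p f (w2, w1).
Proof.
rewrite /cond_copy /= [f w2 == _]eq_sym [p w2 * _]mulrC.
by case: eqP => [->|] //; rewrite !mulr0 !mul0r.
Qed.

Lemma cond_copy_fst (R : realType) (Om : finType) (p : Om -> R) (S : eqType)
  (f : Om -> S) (F : Om -> R) :
  pmf p -> \sum_w cond_copy p f w * F w.1 = \sum_w p w * F w.
Proof.
move=> pp; transitivity (\sum_w1 \sum_w2 cond_copy p f (w1, w2) * F w1).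
  by rewrite pair_bigA; apply: eq_bigr => -[].
apply: eq_bigr => w1 _; rewrite -mulr_suml; congr (_ * _).
rewrite -[RHS](mass_divK f w1 pp) [X in _ = _ * X]massE mulr_sumr.
by apply: eq_bigr => w2 _; rewrite /cond_copy /= eq_sym; ring.
Qed.

Lemma cond_copy_snd (R : realType) (Om : finType) (p : Om -> R) (S : eqType)
  (f : Om -> S) (F : Om -> R) :
  pmf p -> \sum_w cond_copy p f w * F w.2 = \sum_w p w * F w.
Proof.
move=> pp; have inj : injective (fun w : Om * Om => (w.2, w.1)).
  by move=> [? ?] [? ?] [-> ->].
rewrite -(cond_copy_fst f F pp) (reindex_inj inj) /=.
by apply: eq_bigr => -[w1 w2] _; rewrite cond_copy_swap.
Qed.

Lemma cond_copy_pmf (R : realType) (Om : finType) (p : Om -> R) (S : eqType)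
  (f : Om -> S) : pmf p -> pmf (cond_copy p f).
Proof.
move=> pp; split=> [w|].
  by rewrite /cond_copy !mulr_ge0 ?invr_ge0 ?mass_ge0 ?pp.1 ?ler0n.
rewrite -[RHS]pp.2 (eq_bigr (fun w => cond_copy p f w * 1)).
  by rewrite (cond_copy_fst f (fun=> 1)) //; apply: eq_bigr => w _; rewrite mulr1.
by move=> w _; rewrite mulr1.
Qed.

Lemma cond_copy_gt0 (R : realType) (Om : finType) (p : Om -> R) (S : eqType)
  (f : Om -> S) (w : Om * Om) : pmf p -> 0 < cond_copy p f w ->
  [/\ 0 < p w.1, 0 < p w.2 & f w.1 = f w.2].
Proof.
rewrite /cond_copy => pp.
have [->|p1] := eqVneq (p w.1) 0; first by rewrite !mul0r ltxx.
have [->|p2] := eqVneq (p w.2) 0; first by rewrite !(mulr0, mul0r) ltxx.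
case: eqP => [e|]; last by rewrite !(mulr0, mul0r) ltxx.
by rewrite !(pmf_gt0 pp).
Qed.

Lemma ent_fst (R : realType) (Om : finType) (p : Om -> R) (S V : eqType)
  (f : Om -> S) (g : Om -> V) :
  pmf p -> ent (cond_copy p f) (fun w => g w.1) = ent p g.
Proof.
move=> pp; rewrite /ent -(cond_copy_fst f (fun w => log2 (mass p g (g w))) pp).
congr (- _); apply: eq_bigr => w _; congr (_ * log2 _).
by rewrite !massE -(cond_copy_fst f (fun w1 => (g w1 == g w.1)%:R)).
Qed.

Lemma ent_snd (R : realType) (Om : finType) (p : Om -> R) (S V : eqType)
  (f : Om -> S) (g : Om -> V) :
  pmf p -> ent (cond_copy p f) (fun w => g w.2) = ent p g.
Proof.
move=> pp; rewrite /ent -(cond_copy_snd f (fun w => log2 (mass p g (g w))) pp).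
congr (- _); apply: eq_bigr => w _; congr (_ * log2 _).
by rewrite !massE -(cond_copy_snd f (fun w1 => (g w1 == g w.2)%:R)).
Qed.

(** As [g] and [h] both determine [f], the indicator in [cond_copy] equals [1] on this whole fibre,
    so the sum factors. *)
Lemma mass_cond_copy (R : realType) (Om : finType) (p : Om -> R)
  (S V W : eqType) (f : Om -> S) (g : Om -> V) (h : Om -> W) (w : Om * Om) :
  (forall w w', g w = g w' -> f w = f w') ->
  (forall w w', h w = h w' -> f w = f w') -> f w.1 = f w.2 ->
  mass (cond_copy p f) (fun w => (g w.1, h w.2)) (g w.1, h w.2)
  = mass p g (g w.1) * mass p h (h w.2) / mass p f (f w.1).
Proof.
move=> gf hf e; rewrite [LHS]massE [mass p g _]massE [mass p h _]massE.
rewrite big_distrlr /= pair_bigA mulr_suml /=.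
apply: eq_bigr => -[w1 w2] _ /=.
rewrite /cond_copy xpair_eqE /= -mulnb natrM.
have [/gf e1|_] := eqVneq (g w1) _; last by rewrite ?(mulr0, mul0r).
have [/hf e2|_] := eqVneq (h w2) _; last by rewrite ?(mulr0, mul0r).
by rewrite e1 e2 e eqxx !mulr1; ring.
Qed.

(** The logarithm of the factored mass splits. Both copies carry the shared value of [f], which must
    be counted only once. *)
Lemma ent_cond_copy (R : realType) (Om : finType) (p : Om -> R)
  (S V W : eqType) (f : Om -> S) (g : Om -> V) (h : Om -> W) : pmf p ->
  (forall w w', g w = g w' -> f w = f w') ->
  (forall w w', h w = h w' -> f w = f w') ->
  ent (cond_copy p f) (fun w => (g w.1, h w.2)) = ent p g + ent p h - ent p f.
Proof.
move=> pp gf hf; have pp' := cond_copy_pmf f pp.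
rewrite -(ent_fst f g pp) -(ent_snd f h pp) /ent.
rewrite -(cond_copy_fst f (fun w => log2 (mass p f (f w))) pp).
rewrite -!sumrN -!big_split; apply: eq_bigr => w _ /=.
have [->|pw] := eqVneq (cond_copy p f w) 0; first by ring.
have [p1 p2 e] := cond_copy_gt0 pp (pmf_gt0 pp' pw).
rewrite mass_cond_copy // log2M ?log2V ?log2M ?invr_gt0 ?mulr_gt0 ?mass_gt0 //.
have -> : mass (cond_copy p f) (fun w => g w.1) (g w.1) = mass p g (g w.1).
  by rewrite !massE -(cond_copy_fst f (fun w1 => (g w1 == g w.1)%:R)).
have -> : mass (cond_copy p f) (fun w => h w.2) (h w.2) = mass p h (h w.2).
  by rewrite !massE -(cond_copy_snd f (fun w1 => (h w1 == h w.2)%:R)).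
ring.
Qed.

(** Working form: [h] is the form to bound, computable in two ways, and [k] is a tuple of known
    large entropy. *)
Lemma ent_submod_le (R : realType) (Om : finType) (p : Om -> R)
  (W U V X : eqType) (h : Om -> W) (f : Om -> U) (g : Om -> V) (k : Om -> X) :
  pmf p -> refines p f h -> refines p g h -> refines p (fun w => (f w, g w)) k ->
  ent p h + ent p k <= ent p f + ent p g.
Proof.
move=> pp fh gh fgk; apply: le_trans (ent_submod pp fh gh).
by rewrite lerD2l ent_mono.
Qed.

(** * Sums and dilates of nearly independent variables *)

Ltac determined := move=> /=;
  repeat match goal with
  | H : (_, _) = (_, _) |- _ => injection H; clear H; intros
  | |- (_, _) = (_, _) -> _ => let H := fresh in intro H
  | |- _ = _ -> _ => let H := fresh in intro H
  | |- (_, _) = (_, _) => apply: f_equal2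
  end; lra.

(* [A] and [B] are nearly independent, and [A], [B] and [A - B] all have entropy
   about [x]; the lower bounds are implied by subadditivity. *)
Definition near {R : realType} {Om : finType} (p : Om -> R) (A B : Om -> R)
  (x e : R) : Prop :=
  [/\ ent p A <= x + e, ent p B <= x + e,
      2 * x - e <= ent p (fun w => (A w, B w)) &
      ent p (fun w => A w - B w) <= x + e].

Lemma near_ge0 (R : realType) (Om : finType) (p : Om -> R) (A B : Om -> R)
  (x e : R) : pmf p -> near p A B x e -> 0 <= e.
Proof. by move=> pp [hA hB hAB _]; have := ent_subadd A B pp; lra. Qed.

Lemma near_sym (R : realType) (Om : finType) (p : Om -> R) (A B : Om -> R)
  (x e : R) : pmf p -> near p A B x e -> near p B A x e.
Proof.
move=> pp [hA hB hAB hD]; split => //.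
  rewrite (@ent_eq _ _ p _ _ (fun w => (A w, B w))) //.
    by move=> w w' _ _; determined.
  by move=> w w' _ _; determined.
rewrite (@ent_eq _ _ p _ _ (fun w => A w - B w)) //.
  by move=> w w' _ _; determined.
by move=> w w' _ _; determined.
Qed.

(* [p'] is the law of a Markov path [a1 - b1 - a2 - b2] each of whose edges is
   distributed as the pair [(A, B)]. *)
Lemma near_path (R : realType) (Om : finType) (p : Om -> R) (A B : Om -> R)
  (x e : R) : pmf p -> near p A B x e ->
  exists (Om' : finType) (p' : Om' -> R) (a1 b1 a2 b2 : Om' -> R),
  [/\ pmf p', 4 * x - 5 * e <= ent p' (fun w => (a1 w, b1 w, a2 w, b2 w)),
    [/\ ent p' a1 <= x + e, ent p' b1 <= x + e, ent p' a2 <= x + e &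
        ent p' b2 <= x + e],
    [/\ ent p' (fun w => a1 w - b1 w) <= x + e,
        ent p' (fun w => a2 w - b1 w) <= x + e &
        ent p' (fun w => a2 w - b2 w) <= x + e] &
    ent p' (fun w => a2 w + b1 w) = ent p (fun w => A w + B w)].
Proof.
move=> pp [hA hB hAB hD].
(* Gluing at [B] and then at the second [A] makes [w.1.1], [w.1.2], [w.2.2] the successive edges of
   the path. *)
pose p1 := cond_copy p B; have pp1 : pmf p1 by exact: cond_copy_pmf.
pose f1 (w : Om * Om) := A w.2.
pose p2 := cond_copy p1 f1; have pp2 : pmf p2 by exact: cond_copy_pmf.
have supp w : 0 < p2 w ->
    [/\ A w.1.2 = A w.2.2, B w.1.1 = B w.1.2 & B w.2.1 = B w.2.2].
  move=> /(cond_copy_gt0 pp1)[w1 w2 e0].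
  have [_ _ e1] := cond_copy_gt0 pp w1.
  by have [_ _ e2] := cond_copy_gt0 pp w2.
have ent21 (V : eqType) (g : Om * Om -> V) : ent p2 (fun w => g w.1) = ent p1 g.
  exact: ent_fst.
have ent22 (V : eqType) (g : Om * Om -> V) : ent p2 (fun w => g w.2) = ent p1 g.
  exact: ent_snd.
have ent11 (V : eqType) (g : Om -> V) : ent p1 (fun w => g w.1) = ent p g.
  exact: ent_fst.
have ent12 (V : eqType) (g : Om -> V) : ent p1 (fun w => g w.2) = ent p g.
  exact: ent_snd.
exists ((Om * Om) * (Om * Om))%type, p2, (fun w => A w.1.1), (fun w => B w.1.1),
  (fun w => A w.1.2), (fun w => B w.2.2); split=> //.
- have J1 : ent p1 (fun w => ((A w.1, B w.1), (A w.2, B w.2)))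
      = 2 * ent p (fun w => (A w, B w)) - ent p B.
    rewrite (@ent_cond_copy _ _ p _ _ _ B (fun w => (A w, B w))
      (fun w => (A w, B w))) //.
    + ring.
    + by move=> w w' [].
    + by move=> w w' [].
  have J2 : ent p2 (fun w =>
        ((A w.1.1, B w.1.1), (A w.1.2, B w.1.2), (A w.2.2, B w.2.2)))
      = 3 * ent p (fun w => (A w, B w)) - ent p B - ent p A.
    rewrite (@ent_cond_copy _ _ p1 _ _ _ f1
      (fun w => ((A w.1, B w.1), (A w.2, B w.2))) (fun w => (A w.2, B w.2))) //.
    + rewrite J1 /f1 ent12 (ent12 _ (fun w => (A w, B w))); ring.
    + by move=> w w' [].
    + by move=> w w' [].
  (* Three edges less two shared vertices: [3 * (2 * x - e) - 2 * (x + e) = 4 * x - 5 * e]. *)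
  apply: (@le_trans _ _
    (3 * ent p (fun w => (A w, B w)) - ent p B - ent p A)); first lra.
  rewrite -J2; apply: ent_mono => // w w' /supp[? ? ?] /supp[? ? ?]; determined.
- by rewrite (ent21 _ (fun w => A w.1)) (ent21 _ (fun w => B w.1))
    (ent21 _ (fun w => A w.2)) (ent22 _ (fun w => B w.2)) !ent11 !ent12.
- split.
  + by rewrite (ent21 _ (fun w => A w.1 - B w.1)) (ent11 _ (fun w => A w - B w)).
  + rewrite (@ent_eq _ _ p2 _ _ (fun w => A w.1.2 - B w.1.2)) //.
    * by rewrite (ent21 _ (fun w => A w.2 - B w.2)) (ent12 _ (fun w => A w - B w)).
    * move=> w w' /supp[? ? ?] /supp[? ? ?]; determined.
    * move=> w w' /supp[? ? ?] /supp[? ? ?]; determined.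
  + rewrite (@ent_eq _ _ p2 _ _ (fun w => A w.2.2 - B w.2.2)) //.
    * by rewrite (ent22 _ (fun w => A w.2 - B w.2)) (ent12 _ (fun w => A w - B w)).
    * move=> w w' /supp[? ? ?] /supp[? ? ?]; determined.
    * move=> w w' /supp[? ? ?] /supp[? ? ?]; determined.
- rewrite (@ent_eq _ _ p2 _ _ (fun w => A w.1.2 + B w.1.2)) //.
  + by rewrite (ent21 _ (fun w => A w.2 + B w.2)) (ent12 _ (fun w => A w + B w)).
  + move=> w w' /supp[? ? ?] /supp[? ? ?]; determined.
  + move=> w w' /supp[? ? ?] /supp[? ? ?]; determined.
Qed.

(* Along a path [a1 - b1 - a2 - b2] the alternating sum [a1 - b1 + b2] is small.
   Two paths with common ends [a1], [b2] then express the sum along the middle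
   edge of the first one as
   [a2 + b1 = (a2 - b2) - (a1 - b1) + (a1 - b1' + b2) + b1']. *)
Lemma near_sum (R : realType) (Om : finType) (p : Om -> R) (A B : Om -> R)
  (x e : R) : pmf p -> near p A B x e ->
  ent p (fun w => A w + B w) <= x + 37 * e.
Proof.
move=> pp hn.
have [Om' [p' [a1 [b1 [a2 [b2 [pp' J [ha1 hb1 ha2 hb2] [d11 d21 d22] <-]]]]]]] :=
  near_path pp hn.
have J3 : 3 * x - 6 * e <= ent p' (fun w => (a1 w, b1 w, b2 w)).
  have := ent_subadd (fun w => (a1 w, b1 w, b2 w)) a2 pp'.
  have : ent p' (fun w => (a1 w, b1 w, a2 w, b2 w)) <=
      ent p' (fun w => (a1 w, b1 w, b2 w, a2 w)).
    by apply: ent_mono => // w w' _ _; determined.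
  lra.
have J3' : 3 * x - 6 * e <= ent p' (fun w => (b1 w, a2 w, b2 w)).
  have := ent_subadd (fun w => (b1 w, a2 w, b2 w)) a1 pp'.
  have : ent p' (fun w => (a1 w, b1 w, a2 w, b2 w)) <=
      ent p' (fun w => (b1 w, a2 w, b2 w, a1 w)).
    by apply: ent_mono => // w w' _ _; determined.
  lra.
(* [b2 - b1] comes from its two vertices or from the two edges at [a2]: [4 * x + 4 * e] less
   [3 * x - 6 * e]. *)
have hbb : ent p' (fun w => b2 w - b1 w) <= x + 10 * e.
  have := ent_subadd b1 b2 pp'.
  have := ent_subadd (fun w => a2 w - b1 w) (fun w => a2 w - b2 w) pp'.
  suff : ent p' (fun w => b2 w - b1 w) + ent p' (fun w => (b1 w, a2 w, b2 w))
    <= ent p' (fun w => (b1 w, b2 w))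
       + ent p' (fun w => (a2 w - b1 w, a2 w - b2 w)) by lra.
  by apply: ent_submod_le => // w w' _ _; determined.
(* The two groupings are [a1 + (b2 - b1)] and [(a1 - b1) + b2]. *)
have htriple : ent p' (fun w => a1 w - b1 w + b2 w) <= x + 19 * e.
  have := ent_subadd a1 (fun w => b2 w - b1 w) pp'.
  have := ent_subadd (fun w => a1 w - b1 w) b2 pp'.
  suff : ent p' (fun w => a1 w - b1 w + b2 w)
    + ent p' (fun w => (a1 w, b1 w, b2 w))
    <= ent p' (fun w => (a1 w, b2 w - b1 w))
       + ent p' (fun w => (a1 w - b1 w, b2 w)) by lra.
  by apply: ent_submod_le => // w w' _ _; determined.
pose f w := (a1 w, b2 w); pose p3 := cond_copy p' f.
have pp3 : pmf p3 by exact: cond_copy_pmf.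
have supp w : 0 < p3 w -> a1 w.1 = a1 w.2 /\ b2 w.1 = b2 w.2.
  by move=> /(cond_copy_gt0 pp')[_ _ []].
have ent1 (V : eqType) (g : Om' -> V) : ent p3 (fun w => g w.1) = ent p' g.
  exact: ent_fst.
have ent2 (V : eqType) (g : Om' -> V) : ent p3 (fun w => g w.2) = ent p' g.
  exact: ent_snd.
(* This is [(4 * x - 5 * e) + (3 * x - 6 * e)] less at most [2 * x + 2 * e] for the shared ends. *)
have J5 : 5 * x - 13 * e <= ent p3 (fun w =>
    ((a1 w.1, b1 w.1, a2 w.1, b2 w.1), (a1 w.2, b1 w.2, b2 w.2))).
  rewrite (@ent_cond_copy _ _ p' _ _ _ f (fun w => (a1 w, b1 w, a2 w, b2 w))
     (fun w => (a1 w, b1 w, b2 w))) //.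
  - by have := ent_subadd a1 b2 pp'; rewrite /f; lra.
  - by move=> w w' [? ? ? ?]; rewrite /f; congr (_, _).
  - by move=> w w' [? ? ?]; rewrite /f; congr (_, _).
rewrite -(ent1 _ (fun w => a2 w + b1 w)).
have h1 := ent_subadd (fun w => a2 w.1) (fun w => b1 w.1) pp3.
have h2 := ent_subadd
  (fun w => (a2 w.1 - b2 w.1, a1 w.1 - b1 w.1, a1 w.2 - b1 w.2 + b2 w.2))
  (fun w => b1 w.2) pp3.
have h3 := ent_subadd (fun w => (a2 w.1 - b2 w.1, a1 w.1 - b1 w.1))
  (fun w => a1 w.2 - b1 w.2 + b2 w.2) pp3.
have h4 := ent_subadd (fun w => a2 w.1 - b2 w.1) (fun w => a1 w.1 - b1 w.1) pp3.
rewrite (ent1 _ a2) (ent1 _ b1) in h1.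
rewrite (ent2 _ b1) in h2.
rewrite (ent2 _ (fun w => a1 w - b1 w + b2 w)) in h3.
rewrite (ent1 _ (fun w => a2 w - b2 w)) (ent1 _ (fun w => a1 w - b1 w)) in h4.
(* The right side is at most [(2 * x + 2 * e) + (4 * x + 22 * e)]; subtracting [5 * x - 13 * e]
   leaves [x + 37 * e]. *)
suff : ent p3 (fun w => a2 w.1 + b1 w.1) + ent p3 (fun w =>
    ((a1 w.1, b1 w.1, a2 w.1, b2 w.1), (a1 w.2, b1 w.2, b2 w.2))) <=
    ent p3 (fun w => (a2 w.1, b1 w.1)) + ent p3 (fun w => (a2 w.1 - b2 w.1,
      a1 w.1 - b1 w.1, a1 w.2 - b1 w.2 + b2 w.2, b1 w.2)) by lra.
by apply: ent_submod_le => // w w' /supp[? ?] /supp[? ?]; determined.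
Qed.

(** * Sign changes and integer linear combinations *)

Lemma near_opp (R : realType) (Om : finType) (p : Om -> R) (A B : Om -> R)
  (x e : R) : pmf p -> near p A B x e -> near p A (fun w => - B w) x (37 * e).
Proof.
move=> pp hn; have := near_sum pp hn; have e0 := near_ge0 pp hn.
case: hn => hA hB hAB hD hS; split; first by lra.
- rewrite (@ent_eq _ _ p _ _ B) //; first by lra.
  + by move=> w w' _ _; determined.
  + by move=> w w' _ _; determined.
- rewrite (@ent_eq _ _ p _ _ (fun w => (A w, B w))) //; first by lra.
  + by move=> w w' _ _; determined.
  + by move=> w w' _ _; determined.
- rewrite (@ent_eq _ _ p _ _ (fun w => A w + B w)) //.
  + by move=> w w' _ _; determined.
  + by move=> w w' _ _; determined.
Qed.

(** A second copy of [A] over the same [B] supplies a third variable through which linear forms can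
    be rewritten; the last clause carries the bounds back to [A] and [B]. *)
Lemma near_fork (R : realType) (Om : finType) (p : Om -> R) (A B : Om -> R)
  (x e : R) : pmf p -> near p A B x e ->
  exists (Om' : finType) (p' : Om' -> R) (X Y X' : Om' -> R),
  [/\ pmf p', 3 * x - 3 * e <= ent p' (fun w => (X w, Y w, X' w)),
    [/\ near p' X Y x e, near p' X' Y x e & near p' X X' x (7 * e)] &
    forall F : R -> R -> R,
      ent p' (fun w => F (X w) (Y w)) = ent p (fun w => F (A w) (B w))].
Proof.
move=> pp [hA hB hAB hD].
pose p1 := cond_copy p B; have pp1 : pmf p1 by exact: cond_copy_pmf.
have supp w : 0 < p1 w -> B w.1 = B w.2.
  by move=> /(cond_copy_gt0 pp)[].
have ent1 (V : eqType) (g : Om -> V) : ent p1 (fun w => g w.1) = ent p g.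
  exact: ent_fst.
have ent2 (V : eqType) (g : Om -> V) : ent p1 (fun w => g w.2) = ent p g.
  exact: ent_snd.
have J : 3 * x - 3 * e <= ent p1 (fun w => (A w.1, B w.1, A w.2)).
  apply: (@le_trans _ _ (2 * ent p (fun w => (A w, B w)) - ent p B)); first lra.
  apply: (@le_trans _ _ (ent p1 (fun w => ((A w.1, B w.1), (A w.2, B w.2))))).
    rewrite (@ent_cond_copy _ _ p _ _ _ B (fun w => (A w, B w))
      (fun w => (A w, B w))) //; first lra.
    - by move=> w w' [].
    - by move=> w w' [].
  by apply: ent_mono => // w w' /supp ? /supp ?; determined.
have nXY : near p1 (fun w => A w.1) (fun w => B w.1) x e.
  split; [by rewrite ent1|by rewrite ent1| |].
  - by rewrite (ent1 _ (fun w => (A w, B w))).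
  - by rewrite (ent1 _ (fun w => A w - B w)).
have nX'Y : near p1 (fun w => A w.2) (fun w => B w.1) x e.
  split; [by rewrite ent2|by rewrite ent1| |].
  - rewrite (@ent_eq _ _ p1 _ _ (fun w => (A w.2, B w.2))) //.
    + by rewrite (ent2 _ (fun w => (A w, B w))).
    + by move=> w w' /supp ? /supp ?; determined.
    + by move=> w w' /supp ? /supp ?; determined.
  - rewrite (@ent_eq _ _ p1 _ _ (fun w => A w.2 - B w.2)) //.
    + by rewrite (ent2 _ (fun w => A w - B w)).
    + by move=> w w' /supp ? /supp ?; determined.
    + by move=> w w' /supp ? /supp ?; determined.
exists (Om * Om)%type, p1, (fun w => A w.1), (fun w => B w.1), (fun w => A w.2).
split=> //; last by move=> F; rewrite (ent1 _ (fun w => F (A w) (B w))).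
split=> //; have e0 := near_ge0 pp1 nXY.
case: nXY nX'Y => [hX hY hXY dXY] [hX' _ _ dX'Y]; split; [lra|lra| |].
- have := ent_subadd (fun w => (A w.1, A w.2)) (fun w => B w.1) pp1.
  suff : ent p1 (fun w => (A w.1, B w.1, A w.2)) <=
    ent p1 (fun w => (A w.1, A w.2, B w.1)) by lra.
  by apply: ent_mono => // w w' _ _; determined.
(* The common [B] cancels between the two differences: [4 * x + 4 * e] less [3 * x - 3 * e] gives
   [7 * e]. *)
- have := ent_subadd (fun w => A w.1) (fun w => A w.2) pp1.
  have := ent_subadd (fun w => A w.1 - B w.1) (fun w => A w.2 - B w.1) pp1.
  suff : ent p1 (fun w => A w.1 - A w.2)
    + ent p1 (fun w => (A w.1, B w.1, A w.2))
    <= ent p1 (fun w => (A w.1, A w.2))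
       + ent p1 (fun w => (A w.1 - B w.1, A w.2 - B w.1)) by lra.
  by apply: ent_submod_le => // w w' _ _; determined.
Qed.

(* Induction step: [X - (a+1) Y = (X - Y - a X') - a (Y - X')], with [X'] a
   conditionally independent copy of [X] given [Y]. *)
Lemma near_dilate (R : realType) (a : nat) : exists C : nat,
  forall (Om : finType) (p : Om -> R) (A B : Om -> R) (x e : R),
  pmf p -> near p A B x e -> ent p (fun w => A w - a%:R * B w) <= x + C%:R * e.
Proof.
elim: a => [|a [C IH]].
  exists 1%N => Om p A B x e pp [hA _ _ _].
  rewrite (@ent_eq _ _ p _ _ A) //; first by lra.
  - by move=> w w' _ _; determined.
  - by move=> w w' _ _; determined.
(* The first submodularity step gives [6 + 37 * C] for [X - Y - a X'], and the second adds [6]. *)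
exists (12 + 37 * C)%N => Om p A B x e pp hn.
have [Om' [p' [X [Y [X' [pp' J [nXY nX'Y _] F]]]]]] := near_fork pp hn.
rewrite -(F (fun s t => s - a.+1%:R * t)).
(* The induction hypothesis is applied to [Y] and [- X'], which bounds [Y + a X']; the sign change
   costs the factor [37]. *)
have := IH _ _ _ _ _ _ pp' (near_opp pp' (near_sym pp' nX'Y)).
have -> : (12 + 37 * C)%:R = 12 + 37 * C%:R :> R.
  by rewrite (natrD R 12 (37 * C)) (natrM R 37 C).
rewrite (@ent_eq _ _ p' _ _ (fun w => Y w + a%:R * X' w)) //; first last.
- by move=> w w' _ _; determined.
- by move=> w w' _ _; determined.
move=> hYX'; case: nXY => hX hY _ dXY; case: nX'Y => hX' _ _ dX'Y.
have h1 := ent_subadd X (fun w => Y w + a%:R * X' w) pp'.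
have h2 := ent_subadd (fun w => X w - Y w) X' pp'.
have h3 := ent_subadd X Y pp'.
have h4 := ent_subadd (fun w => X w - Y w - a%:R * X' w) (fun w => X' w - Y w) pp'.
have k1 : ent p' (fun w => X w - Y w - a%:R * X' w)
    + ent p' (fun w => (X w, Y w, X' w))
    <= ent p' (fun w => (X w, Y w + a%:R * X' w))
       + ent p' (fun w => (X w - Y w, X' w)).
  apply: ent_submod_le => // w w' _ _ /=; try by determined.
  by move=> [e1 e2]; rewrite e1 e2.
suff : ent p' (fun w => X w - a.+1%:R * Y w)
    + ent p' (fun w => (X w, Y w, X' w))
    <= ent p' (fun w => (X w, Y w))
       + ent p' (fun w => (X w - Y w - a%:R * X' w, X' w - Y w)) by lra.
apply: ent_submod_le => // w w' _ _ /=; try by determined.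
- by move=> [-> ->].
- have E v : X v - a.+1%:R * Y v = (X v - Y v - a%:R * X' v) + a%:R * (X' v - Y v).
    by rewrite -natr1; ring.
  by move=> [e1 e2]; rewrite !E e1 e2.
Qed.

Lemma near_dilatez (R : realType) (a : int) : exists C : nat,
  forall (Om : finType) (p : Om -> R) (A B : Om -> R) (x e : R),
  pmf p -> near p A B x e -> ent p (fun w => A w - a%:~R * B w) <= x + C%:R * e.
Proof.
case: a => n.
  by have [C hC] := near_dilate R n; exists C.
(* [Negz n] stands for [- n.+1]; its sign is moved onto [B], at the cost of the factor [37]. *)
have [C hC] := near_dilate R n.+1; exists (C * 37)%N => Om p A B x e pp hn.
have := hC _ _ _ _ _ _ pp (near_opp pp hn).
rewrite natrM mulrA (@ent_eq _ _ p _ _ (fun w => A w - (Negz n)%:~R * B w)) //.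
- by move=> w w' _ _; rewrite NegzE mulrNz !mulNr !mulrN.
- by move=> w w' _ _; rewrite NegzE mulrNz !mulNr !mulrN.
Qed.

(* [a A + b B = a (A - b t) + b (B + a t)], with [t] a conditionally
   independent copy of [A] given [B]. *)
Lemma near_comb (R : realType) (a b : int) : a != 0 -> exists C : nat,
  forall (Om : finType) (p : Om -> R) (A B : Om -> R) (x e : R),
  pmf p -> near p A B x e ->
  ent p (fun w => a%:~R * A w + b%:~R * B w) <= x + C%:R * e.
Proof.
move=> a0; have [C1 IH1] := near_dilatez R b.
have [C2 IH2] := near_dilatez R (- a).
(* The pair [X], [t] is near with error [7 * e], hence [7 * C1]; the [5] is [2] from [X] and [Y]
   plus [3] from the triple. *)
exists (5 + 7 * C1 + C2)%N => Om p A B x e pp hn.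
have [Om' [p' [X [Y [t [pp' J [nXY ntY nXt] F]]]]]] := near_fork pp hn.
rewrite -(F (fun u v => a%:~R * u + b%:~R * v)).
have := IH2 _ _ _ _ _ _ pp' (near_sym pp' ntY).
have := IH1 _ _ _ _ _ _ pp' nXt.
case: nXY => hX hY _ dXY i1 i2.
have -> : (5 + 7 * C1 + C2)%:R = 5 + 7 * C1%:R + C2%:R :> R.
  by rewrite (natrD R (5 + 7 * C1)) (natrD R 5 (7 * C1)) (natrM R 7 C1).
have h1 := ent_subadd X Y pp'.
have h2 := ent_subadd (fun w => X w - b%:~R * t w)
  (fun w => Y w - (- a)%:~R * t w) pp'.
suff : ent p' (fun w => a%:~R * X w + b%:~R * Y w)
    + ent p' (fun w => (X w, Y w, t w))
    <= ent p' (fun w => (X w, Y w))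
       + ent p' (fun w => (X w - b%:~R * t w, Y w - (- a)%:~R * t w)) by lra.
apply: ent_submod_le => // w w' _ _ /=.
- by move=> [-> ->].
- have E v : a%:~R * X v + b%:~R * Y v = a%:~R * (X v - b%:~R * t v)
      + b%:~R * (Y v - (- a)%:~R * t v) by rewrite mulrNz; ring.
  by move=> [e1 e2]; rewrite !E e1 e2.
(* Once [Y] is known, [a != 0] recovers [t] from [Y + a t]. *)
- have aR : a%:~R != 0 :> R by rewrite intr_eq0.
  move=> [-> -> _]; rewrite mulrNz => /addrI /oppr_inj /mulfI ->//.
  by rewrite oppr_eq0.
Qed.

(** * Reduction to finite probability spaces *)

Lemma ent_sum (R : realType) (Om : finType) (p : Om -> R) (V : choiceType)
  (f : Om -> V) :
  ent p f = \sum_(v \in range f) - (mass p f v * log2 (mass p f v)).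
Proof.
pose r := undup [seq f w | w <- index_enum Om].
have fr w : f w \in r by rewrite mem_undup map_f ?mem_index_enum.
have -> : range f = [set` r].
  apply/seteqP; split=> [_ [w _ <-]|v] /=; first exact: fr.
  by rewrite mem_undup => /mapP[w _ ->]; exists w.
rewrite -fsbig_seq ?undup_uniq // sumrN /ent; congr (- _).
transitivity (\sum_(v <- r) \sum_(w | f w == v) p w * log2 (mass p f v)).
  rewrite (exchange_big_dep xpredT) //=; apply: eq_bigr => w _.
  rewrite big_mkcond (bigD1_seq (f w)) ?undup_uniq //= eqxx big1 ?addr0 //.
  by move=> v; rewrite eq_sym => /negbTE ->.
by apply: eq_bigr => v _; rewrite -mulr_suml.
Qed.

Definition discrete {d} {T : measurableType d} {V : Type} (f : T -> V) : Prop :=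
  finite_set (range f) /\ forall v, measurable (f @^-1` [set v]).

Lemma discrete_pair d (T : measurableType d) (V W : Type) (f : T -> V)
  (g : T -> W) : discrete f -> discrete g -> discrete (fun t => (f t, g t)).
Proof.
move=> [ff mf] [fg mg]; split.
  apply: sub_finite_set (finite_setX ff fg) => _ [t _ <-].
  by split; exists t.
move=> [v w]; have -> : (fun t => (f t, g t)) @^-1` [set (v, w)]
    = f @^-1` [set v] `&` g @^-1` [set w].
  by apply/seteqP; split => t /= [-> ->].
exact: measurableI.
Qed.

(** The finite space is the range of [G] with the pushforward law. Quantifying over [phi] puts all
    functions of [G] on one space, and [range G (S w)] preserves the relations between its
    coordinates. *)
Lemma discrete_pmf d (T : measurableType d) (R : realType)
  (P : probability T R) (V : choiceType) (G : T -> V) : discrete G ->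
  exists (Om : finType) (p : Om -> R) (S : Om -> V),
  [/\ pmf p, forall w, range G (S w) &
    forall (W : choiceType) (phi : V -> W),
      entropy P (fun t => phi (G t)) = ent p (fun w => phi (S w))].
Proof.
move=> [fG mG]; pose Om := fset_set (range G); pose S (w : Om) : V := val w.
have rS w : range G (S w).
  by have := fsvalP w; rewrite in_fset_set // inE.
have Sr t : exists w, S w = G t.
  have h : G t \in fset_set (range G) by rewrite in_fset_set // inE; exists t.
  by exists [` h]%fset.
pose p w := fine (P (G @^-1` [set S w])).
have mass_p (W : choiceType) (phi : V -> W) v :
    mass p (fun w => phi (S w)) v = fine (P ((fun t => phi (G t)) @^-1` [set v])).
  pose Q := [pred w | phi (S w) == v].
  have -> : (fun t => phi (G t)) @^-1` [set v]
      = \bigcup_(w in [set` Q]) (G @^-1` [set S w]).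
    apply/seteqP; split => [t /= e|t /= [w /eqP e ->//]].
    have [w wt] := Sr t; exists w => //=.
    by rewrite inE /= wt; apply/eqP.
  rewrite measure_fin_bigcup //.
  - rewrite -(@bigfs _ _ _ _ (index_enum Om)) ?index_enum_uniq //; last first.
      by move=> i _; rewrite mem_index_enum.
    rewrite -sum_fine //= => i _; exact: fin_num_measure.
  - move=> i j _ _ [t [e1 e2]]; apply: val_inj; exact: etrans (esym e1) e2.
exists Om, p, S; split => //.
  split=> [w|]; first exact: fine_ge0.
  have := mass_p unit (fun=> tt) tt.
  rewrite (_ : _ @^-1` _ = setT); last by apply/seteqP; split.
  rewrite probability_setT /= => <-; rewrite /mass.
  by apply: eq_bigl => w; rewrite eqxx.
move=> W phi; rewrite ent_sum /entropy.
have -> : range (fun t => phi (G t)) = range (fun w => phi (S w)).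
  apply/seteqP; split=> [v [t _ <-]|v [w _ <-]].
    by have [w <-] := Sr t; exists w.
  by have [t _ <-] := rS w; exists t.
by apply: eq_fsbigr => v _; rewrite mass_p.
Qed.

(** * Dyadic discretization and rounding errors *)

Lemma Dn_discrete d (T : measurableType d) (R : realType) (n : nat)
  (Z : T -> R) : measurable_fun setT Z -> (exists M : R, forall t, `|Z t| <= M) ->
  discrete (fun t => Dn n (Z t)).
Proof.
move=> mZ [M ZM]; split.
  pose m := Num.bound (2 ^+ n * `|M|).
  have mM : 2 ^+ n * `|M| < m%:R by apply: archi_boundP; rewrite mulr_ge0.
  (* The floors lie between [- m] and [m]; shifting by [m] indexes them by [2 * m + 1] naturals. *)
  apply: (@sub_finite_set _ _
    [set ((i%:R - m%:R) / 2 ^+ n : R) | i in `I_(2 * m).+1]); last first.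
    exact/finite_image/finite_II.
  move=> _ [t _ <-]; pose z := 2 ^+ n * Z t.
  have /andP[z1 z2] : - m%:R <= z <= m%:R.
    rewrite -ler_norml /z normrM ger0_norm ?exprn_ge0 //.
    apply: le_trans (ltW mM); rewrite ler_wpM2l ?exprn_ge0 //.
    exact: le_trans (ZM t) (ler_norm _).
  have f1 : - m%:Z <= Num.floor z by rewrite floor_ge_int mulrNz.
  have f2 : Num.floor z <= m%:Z.
    by rewrite -(ler_int R) (le_trans (floor_le z)).
  have f3 : 0 <= Num.floor z + m%:Z by rewrite -lerBlDr sub0r.
  exists (absz (Num.floor z + m%:Z)) => /=.
    by rewrite ltnS -lez_nat gez0_abs //; lia.
  by rewrite natr_absz ger0_norm // /Dn -/z rmorphD /= addrK.
have mD : measurable_fun setT (fun t => Dn n (Z t)).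
  apply: (measurableT_comp _ mZ); apply: nondecreasing_measurable => // x y xy.
  rewrite /Dn ler_wpM2r ?invr_ge0 ?exprn_ge0 // ler_int le_floor //.
  by rewrite ler_wpM2l ?exprn_ge0.
move=> v; rewrite -[X in measurable X]setTI.
by apply: mD => //; exact: measurable_set1.
Qed.

(* [U] lies in the grid of mesh [1/N], so it is recovered from [V] together with
   one of boundedly many grid displacements. *)
Lemma ent_grid (R : realType) (Om : finType) (p : Om -> R) (U V : Om -> R)
  (N : R) (m : Om -> int) (c : nat) : pmf p -> 0 < N ->
  (forall w, N * U w = (m w)%:~R) -> (forall w, `|N * U w - N * V w| <= c%:R) ->
  ent p U <= ent p V + (2 * c + 2)%:R / ln 2.
Proof.
move=> pp N0 Um UV; pose D w := m w - Num.floor (N * V w) + c%:Z.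
have D0 w : 0 <= D w <= (2 * c + 1)%:Z.
  have /andP[h1 h2] := floor_itv (N * V w).
  have := UV w; rewrite ler_norml Um => /andP[h3 h4].
  have h5 : Num.floor (N * V w) <= m w + c%:Z.
    by rewrite -(ler_int R) rmorphD /=; lra.
  have h6 : m w < Num.floor (N * V w) + 1 + c%:Z.
    by rewrite -(ltr_int R) rmorphD /=; lra.
  by rewrite /D; lia.
pose J w : 'I_(2 * c + 1).+1 := inord (absz (D w)).
apply: (@le_trans _ _ (ent p (fun w => (V w, J w)))).
  apply: ent_mono => // w w' _ _ [eV /(congr1 val)] /=.
  have /andP[a1 a2] := D0 w; have /andP[b1 b2] := D0 w'.
  rewrite !inordK ?ltnS -?lez_nat ?gez0_abs // => eD.
  have : D w = D w' by rewrite -(gez0_abs a1) -(gez0_abs b1) eD.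
  rewrite /D eV => /addIr /addIr em.
  by apply: (mulfI (lt0r_neq0 N0)); rewrite !Um em.
apply: le_trans (ent_subadd V J pp) _; rewrite lerD2l.
by apply: le_trans (ent_le_card J pp) _; rewrite card_ord addn1 addn2.
Qed.

Lemma Dn_grid (R : realType) (n : nat) (x : R) :
  2 ^+ n * Dn n x = (Num.floor (2 ^+ n * x))%:~R.
Proof. by rewrite /Dn mulrCA divff ?mulr1 // expf_neq0 ?pnatr_eq0. Qed.

Lemma Dn_gridK (R : realType) (n : nat) (x : R) :
  2 ^+ n * Dn n x = (Num.floor (2 ^+ n * Dn n x))%:~R.
Proof. by rewrite !Dn_grid intrKfloor. Qed.

Lemma Dn_itv (R : realType) (n : nat) (x : R) :
  0 <= 2 ^+ n * x - 2 ^+ n * Dn n x <= 1.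
Proof.
rewrite Dn_grid; have /andP[] := floor_itv (2 ^+ n * x).
rewrite intrD; lra.
Qed.

(** Each variable is recovered from the sum and the other one, so its entropy exceeds that of the
    sum by at most the mutual information, which is nonnegative. Passing to [- B] turns the sum into
    a difference. *)
Lemma near_add (R : realType) (Om : finType) (p : Om -> R) (A B : Om -> R) :
  pmf p ->
  near p A (fun w => - B w) ((ent p A + ent p B) / 2)
    (ent p (fun w => A w + B w) - (ent p A + ent p B) / 2
     + 2 * (ent p A + ent p B - ent p (fun w => (A w, B w)))).
Proof.
move=> pp.
have hB : ent p (fun w => - B w) = ent p B.
  by apply: ent_eq => // w w' _ _; determined.
have hAB : ent p (fun w => (A w, - B w)) = ent p (fun w => (A w, B w)).
  by apply: ent_eq => // w w' _ _; determined.
have hS : ent p (fun w => A w - - B w) = ent p (fun w => A w + B w).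
  by apply: ent_eq => // w w' _ _; determined.
have hI := ent_subadd A B pp.
have hSA := ent_subadd (fun w => A w + B w) A pp.
have hSB := ent_subadd (fun w => A w + B w) B pp.
have kA : ent p (fun w => (A w, B w)) <= ent p (fun w => (A w + B w, A w)).
  by apply: ent_mono => // w w' _ _; determined.
have kB : ent p (fun w => (A w, B w)) <= ent p (fun w => (A w + B w, B w)).
  by apply: ent_mono => // w w' _ _; determined.
by rewrite /near hB hAB hS; split; lra.
Qed.

(** Denominators are cleared: multiplication by the nonzero [q] is injective, so the integer form
    determines the rational one. *)
Lemma ent_comb_rat (R : realType) (k l : rat) : k != 0 -> exists C : nat,
  forall (Om : finType) (p : Om -> R) (A B : Om -> R) (x e : R),
  pmf p -> near p A (fun w => - B w) x e ->
  ent p (fun w => ratr k * A w + ratr l * B w) <= x + C%:R * e.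
Proof.
move=> k0; pose a := numq k * denq l; pose b := numq l * denq k.
have a0 : a != 0 by rewrite mulf_neq0 ?numq_eq0 ?denq_neq0.
have [C hC] := near_comb R (- b) a0; exists C => Om p A B x e pp hn.
pose q : R := (denq k * denq l)%:~R.
have q0 : q != 0 by rewrite intr_eq0 mulf_neq0 ?denq_neq0.
have ak : a%:~R = q * ratr k :> R.
  by rewrite /a /q /ratr !intrM; field; rewrite intr_eq0 denq_neq0.
have bl : b%:~R = q * ratr l :> R.
  by rewrite /b /q /ratr !intrM; field; rewrite intr_eq0 denq_neq0.
have E w : a%:~R * A w + (- b)%:~R * - B w = q * (ratr k * A w + ratr l * B w).
  by rewrite mulrNz ak bl; ring.
apply: le_trans (hC _ _ _ _ _ _ pp hn); apply: ent_mono => // w w' _ _.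
by rewrite !E => /(mulfI q0).
Qed.

Theorem theorem2 (R : realType) (k l : rat) (hk : k != 0) (hl : l != 0) :
  exists (d1 d2 : nat) (K : R), (0 < d1)%N /\
  forall (d : measure_display) (T : measurableType d) (P : probability T R)
         (X Y : T -> R),
    measurable_fun setT X -> measurable_fun setT Y ->
    (exists M : R, forall t, `|X t| <= M) ->
    (exists M : R, forall t, `|Y t| <= M) ->
    forall n : nat,
      Hn P n (fun t => ratr k * X t + ratr l * Y t) - (Hn P n X + Hn P n Y) / 2
      <= d1%:R * (Hn P n (fun t => X t + Y t) - (Hn P n X + Hn P n Y) / 2)
         + d2%:R * (Hn P n X + Hn P n Y - Hn2 P n X Y) + K.
Proof.
have [C hC] := ent_comb_rat R l hk.
pose c := Num.bound (`|ratr k : R| + `|ratr l : R| + 1).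
have hc : `|ratr k : R| + `|ratr l : R| + 1 <= c%:R.
  by apply/ltW/archi_boundP; rewrite !addr_ge0.
pose K1 : R := (2 * 2 + 2)%:R / ln 2; pose K2 : R := (2 * c + 2)%:R / ln 2.
(* [C.+1] ensures positivity, and the error of [near_add] contains the mutual information twice.
   [K1] pays for rounding the sum, hence is multiplied by [C.+1]; [K2] pays for rounding the final
   form. *)
exists C.+1, (2 * C.+1)%N, (C.+1%:R * K1 + K2); split=> //.
move=> d T P X Y mX mY bX bY n.
have comb (u v : R) : measurable_fun setT (fun t => u * X t + v * Y t) /\
    exists M : R, forall t, `|u * X t + v * Y t| <= M.
  split; first by apply: measurable_funD; apply: measurable_funM.
  have [M XM] := bX; have [M' YM] := bY.
  exists (`|u| * M + `|v| * M') => t; apply: le_trans (ler_normD _ _) _.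
  by rewrite !normrM lerD // ler_wpM2l.
have dX := Dn_discrete n mX bX; have dY := Dn_discrete n mY bY.
have dS : discrete (fun t => Dn n (X t + Y t)).
  have [] := comb 1 1; rewrite (_ : (fun t => 1 * X t + 1 * Y t) = X \+ Y).
    move=> mS [M hM]; apply: Dn_discrete => //.
    by exists M => t; have := hM t; rewrite !mul1r.
  by apply/funext => t; rewrite !mul1r.
have dF : discrete (fun t => Dn n (ratr k * X t + ratr l * Y t)).
  by have [mF bF] := comb (ratr k) (ratr l); exact: Dn_discrete.
(* All four discretizations are bundled, so that one finite space carries them jointly. *)
have [Om [p [S [pp rS H]]]] :=
  discrete_pmf P (discrete_pair (discrete_pair (discrete_pair dX dY) dS) dF).
have eX := H _ (fun v => v.1.1.1); have eY := H _ (fun v => v.1.1.2).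
have eS := H _ (fun v => v.1.2); have eF := H _ (fun v => v.2).
have eXY := H _ (fun v => (v.1.1.1, v.1.1.2)).
rewrite /Hn /Hn2 eX eY eS eF eXY {H eX eY eS eF eXY} /=.
pose A w := (S w).1.1.1; pose B w := (S w).1.1.2; pose N : R := 2 ^+ n.
have N0 : 0 < N by rewrite exprn_gt0.
(* Three rounding errors in [[0, 1]], one of sign opposite to the others, give a displacement of at
   most [2]. *)
have hS : ent p (fun w => A w + B w) <= ent p (fun w => (S w).1.2) + K1.
  apply: (@ent_grid _ _ _ _ _ N
    (fun w => Num.floor (N * A w) + Num.floor (N * B w))) => //.
    move=> w; have [t _ e] := rS w.
    by rewrite intrD mulrDr /A /B -e /= -!Dn_gridK.
  move=> w; have [t _ e] := rS w; rewrite /A /B -e /=.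
  have := Dn_itv n (X t); have := Dn_itv n (Y t).
  have := Dn_itv n (X t + Y t); rewrite -/N ler_norml.
  by move=> /andP[? ?] /andP[? ?] /andP[? ?]; lra.
(* Here the discretized form is on the grid while the rational combination need not be; the
   displacement is at most [|k| + |l| + 1]. *)
have hF : ent p (fun w => (S w).2) <=
    ent p (fun w => ratr k * A w + ratr l * B w) + K2.
  apply: (@ent_grid _ _ _ _ _ N (fun w => Num.floor (N * (S w).2))) => //.
    by move=> w; have [t _ e] := rS w; rewrite -e /= -Dn_gridK.
  move=> w; have [t _ e] := rS w; rewrite /A /B -e /=.
  pose r (x : R) := N * x - N * Dn n x.
  have r1 x : `|r x| <= 1.
    by have /andP[h0 h1] := Dn_itv n x; rewrite ger0_norm.
  set z := ratr k * X t + _.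
  have -> : N * Dn n z - N * (ratr k * Dn n (X t) + ratr l * Dn n (Y t))
      = ratr k * r (X t) + ratr l * r (Y t) - r z by rewrite /r /z; ring.
  apply: le_trans hc; apply: le_trans (ler_normB _ _) _; rewrite lerD //.
  apply: le_trans (ler_normD _ _) _; rewrite !normrM.
  by rewrite lerD // ler_piMr.
have hn := near_add A B pp.
have e1 : 0 <= C.+1%:R :> R by rewrite ler0n.
have := hC _ _ _ _ _ _ pp hn; have := near_ge0 pp hn.
set e := (X in 0 <= X) => e0 hcomb.
(* Nonnegativity of [e] allows [C] to be enlarged to [C.+1]. *)
have hcomb' : C%:R * e <= C.+1%:R * e by rewrite ler_wpM2r // ler_nat.
have hmul := ler_wpM2l e1 hS.
rewrite natrM; move: hcomb hcomb' hmul hF; rewrite /e /A /B; lra.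
Qed.
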